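(* Let $I$ be a finite set and let $g$ be any directed graph with vertex set $I$. Then $$\mathcal{P}(z_g)=\operatorname{Cone}\{\,e_i-e_j \mid \text{the edge } (j,i) \text{ is in } g\,\}\subset \mathbb{R}I .$$
   Context: A directed graph $g=(I,E)$ with finite vertex set $I$ has a set $E\subseteq I\times I$ of directed edges (no parallel edges); $(i,j)$ denotes the directed edge from $i$ to $j$. A subset $S\subseteq I$ is a lower half of $g$ if every directed edge of $g$ connecting $S$ and $T=I\setminus S$ is oriented from $S$ to $T$, i.e. there is no edge $(u,v)\in E$ with $u\in I\setminus S$ and $v\in S$. (In particular $\emptyset$ and $I$ are lower halves.) Define $z_g:2^I\to\mathbb{R}\cup\{\infty\}$ by $z_g(A)=0$ if $A$ is a lower half of $g$, and $z_g(A)=\infty$ otherwise. $\mathbb{R}I$ is the real vector space with basis $\{e_i\}_{i\in I}$; its elements are written $x=\sum_{i\in I}x_ie_i$. For a function $z:2^I\to\mathbb{R}\cup\{\infty\}$ with $z(\emptyset)=0$ and $z(I)\neq\infty$, its base polytope is $$\mathcal{P}(z)=\Big\{x\in\mathbb{R}I \;\Big|\; \sum_{i\in I}x_i=z(I)\text{ and }\sum_{i\in A}x_i\le z(A)\text{ for all }A\subseteq I\text{ with }z(A)<\infty\Big\}.$$ $\operatorname{Cone}(X)$ is the convex cone generated by $X$, i.e. the set of all finite linear combinations of elements of $X$ with nonnegative real coefficients (so $\operatorname{Cone}(\emptyset)=\{0\}$). *)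

(* Defs.v *)
From HB Require Import structures.
From mathcomp Require Import all_boot all_order all_algebra.
From mathcomp Require Import boolp classical_sets reals constructive_ereal.

Set Implicit Arguments.
Unset Strict Implicit.
Unset Printing Implicit Defensive.

Import Order.TTheory GRing.Theory Num.Theory.

Local Open Scope ring_scope.
Local Open Scope classical_set_scope.

(* A directed graph on I is its set of edges E : {set I * I}; (i, j) \in E is
   the edge from i to j. Loops are allowed. *)

Definition lower_half (I : finType) (E : {set I * I}) (S : {set I}) : bool :=
  [forall u, forall v, ((u, v) \in E) ==> ~~ ((u \in ~: S) && (v \in S))].

(* \bar R stands for the codomain R U {oo}; z_g never takes the value -oo. *)
Definition zg (R : realType) (I : finType) (E : {set I * I}) (A : {set I}) :
  \bar R := if lower_half E A then 0%E else +oo%E.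

(* R^o is R as a module over itself, so {ffun I -> R^o} is the space RI. *)
Definition basis_vec (R : realType) (I : finType) (i : I) : {ffun I -> R^o} :=
  [ffun k => (k == i)%:R].

Definition base_polytope (R : realType) (I : finType) (z : {set I} -> \bar R) :
  set {ffun I -> R^o} :=
  [set x : {ffun I -> R^o} |
     (\sum_i (x i : R))%:E = z [set: I]%SET /\
     forall A : {set I},
       (z A < +oo)%E -> ((\sum_(i in A) (x i : R))%:E <= z A)%E].

Definition Cone (R : realType) (V : lmodType R) (X : set V) : set V :=
  [set v | exists (n : nat) (c : 'I_n -> R) (u : 'I_n -> V),
     [/\ forall k, 0 <= c k, forall k, X (u k) & v = \sum_(k < n) c k *: u k]].

(* P(z) is only meant for z with z(empty) = 0 and z(I) <> oo; z_g qualifies. *)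
Lemma zg_set0 (R : realType) (I : finType) (E : {set I * I}) :
  zg R E finset.set0 = 0%E.
Proof.
rewrite /zg; suff -> : lower_half E finset.set0 by [].
by apply/forallP => u; apply/forallP => v; rewrite !inE implybT.
Qed.

Lemma zg_setT (R : realType) (I : finType) (E : {set I * I}) :
  zg R E [set: I]%SET = 0%E.
Proof.
rewrite /zg; suff -> : lower_half E [set: I]%SET by [].
by apply/forallP => u; apply/forallP => v; rewrite !inE implybT.
Qed.

(* Main.v *)
Require Import Defs.
From mathcomp Require Import all_boot all_order all_algebra.
From mathcomp Require Import boolp classical_sets reals constructive_ereal.
From mathcomp Require Import lra.

(** The generators e_i - e_j have nonpositive sum over every lower half, which
    gives one inclusion.  Conversely, let x lie in the polytope and x_i > 0.
    The tight lower halves (those over which x sums to 0) are closed under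
    union, so there is a largest one, U, avoiding i.  Since the union of U and
    of the ancestors of i is a lower half, some ancestor j of i outside U has
    x_j < 0.  The vector e_i - e_j is in the cone, as a sum of generators along
    a path from j to i, and a positive multiple t (e_i - e_j) can be subtracted
    from x inside the polytope without destroying a tight set or a zero
    coordinate; the largest such t creates a new one, so this terminates. *)

Set Implicit Arguments.
Unset Strict Implicit.
Unset Printing Implicit Defensive.

Import Order.TTheory GRing.Theory Num.Theory.

Local Open Scope ring_scope.
Local Open Scope classical_set_scope.

(** * Closure properties of generated cones *)

Section ConeTheory.
Variables (R : realType) (V : lmodType R) (X : set V).

Lemma cone0 : Cone X 0.
Proof.
exists 0%N, (fun=> 0), (fun=> 0).
by split=> [//|[]//|]; rewrite big_ord0.
Qed.

Lemma cone_gen v : X v -> Cone X v.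
Proof.
move=> Xv; exists 1%N, (fun=> 1), (fun=> v); split=> //.
by rewrite big_ord1 scale1r.
Qed.

Lemma coneD v w : Cone X v -> Cone X w -> Cone X (v + w).
Proof.
move=> [m [c [u [c0 Xu ->]]]] [n [d [y [d0 Xy ->]]]].
exists (m + n)%N,
  (fun k => match fintype.split k with inl a => c a | inr b => d b end),
  (fun k => match fintype.split k with inl a => u a | inr b => y b end).
split; [by move=> k; case: fintype.split..|].
rewrite big_split_ord /=; congr (_ + _); apply: eq_bigr => k _.
  by rewrite -[lshift _ _]/(unsplit (inl k)) unsplitK.
by rewrite -[rshift _ _]/(unsplit (inr k)) unsplitK.
Qed.

Lemma coneZ a v : 0 <= a -> Cone X v -> Cone X (a *: v).
Proof.
move=> a0 [m [c [u [c0 Xu ->]]]].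
exists m, (fun k => a * c k), u; split=> // [k|]; first exact: mulr_ge0.
by rewrite scaler_sumr; apply: eq_bigr => k _; rewrite scalerA.
Qed.

End ConeTheory.

(** * Lower halves and reachability *)

Section LowerHalves.
Variables (I : finType) (E : {set I * I}).
Implicit Types A B : {set I}.

Lemma lower_halfP A :
  reflect (forall u v, (u, v) \in E -> v \in A -> u \in A) (lower_half E A).
Proof.
apply: (iffP forallP) => [lA u v Euv vA|lA u].
  have /forallP/(_ v) := lA u.
  by rewrite Euv !inE vA andbT negbK.
apply/forallP => v; apply/implyP => Euv; rewrite !inE negb_and negbK.
by case: (boolP (v \in A)) => [/(lA _ _ Euv)->|]; rewrite ?orbT.
Qed.

Lemma lower_halfU A B :
  lower_half E A -> lower_half E B -> lower_half E (A :|: B).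
Proof.
move=> /lower_halfP lA /lower_halfP lB; apply/lower_halfP => u v Euv.
by rewrite !inE => /orP[/(lA _ _ Euv)|/(lB _ _ Euv)] ->; rewrite ?orbT.
Qed.

Lemma lower_halfI A B :
  lower_half E A -> lower_half E B -> lower_half E (A :&: B).
Proof.
move=> /lower_halfP lA /lower_halfP lB; apply/lower_halfP => u v Euv.
by rewrite !inE => /andP[/(lA _ _ Euv)-> /(lB _ _ Euv)->].
Qed.

Definition edge : rel I := fun u v => (u, v) \in E.

Lemma lower_half_ancestors i : lower_half E [set u | connect edge u i]%SET.
Proof.
apply/lower_halfP => u v Euv; rewrite !inE; apply: connect_trans.
exact: connect1.
Qed.

Lemma lower_half_connect A u v :
  lower_half E A -> connect edge u v -> v \in A -> u \in A.
Proof.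
move=> /lower_halfP lA /connectP[p]; elim: p u => [u _ -> //|w p IHp u /=].
by move=> /andP[uw wp] vE vA; apply: lA uw _; apply: IHp wp vE vA.
Qed.

End LowerHalves.

(** * Sums over vertex sets, and the inclusion of the cone in the polytope *)

Section BasePolytope.
Variables (R : realType) (I : finType) (E : {set I * I}).
Implicit Types (x : {ffun I -> R^o}) (A B : {set I}).

Definition sum_on x A : R := \sum_(k in A) x k.

Definition edge_dirs : set {ffun I -> R^o} :=
  [set v | exists i j : I, (j, i) \in E /\ v = basis_vec R i - basis_vec R j].

Lemma sum_onD x y A : sum_on (x + y) A = sum_on x A + sum_on y A.
Proof. by rewrite /sum_on -big_split; apply: eq_bigr => k _; rewrite ffunE. Qed.

Lemma sum_onZ a x A : sum_on (a *: x) A = a * sum_on x A.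
Proof.
by rewrite /sum_on big_distrr; apply: eq_bigr => k _; rewrite ffunE.
Qed.

Lemma sum_on_basis i A : sum_on (basis_vec R i) A = (i \in A)%:R.
Proof.
rewrite /sum_on; have [iA|iA] := boolP (i \in A).
  rewrite (bigD1 i) //= ffunE eqxx big1 ?addr0 // => k /andP[_ /negbTE ki].
  by rewrite ffunE ki.
by rewrite big1 // => k kA; rewrite ffunE; case: eqP kA iA => // -> ->.
Qed.

Lemma sum_on_dir i j A :
  sum_on (basis_vec R i - basis_vec R j) A = (i \in A)%:R - (j \in A)%:R.
Proof. by rewrite -scaleN1r sum_onD sum_onZ mulN1r !sum_on_basis. Qed.

Lemma sum_onUI x A B :
  sum_on x (A :|: B) + sum_on x (A :&: B) = sum_on x A + sum_on x B.
Proof.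
rewrite /sum_on (big_setID A) /= finset.setUK (big_setID A (A := B)) /= -addrA.
rewrite finset.setDUl finset.setDv finset.set0U (finset.setIC B).
by congr (_ + _); rewrite addrC.
Qed.

(** A set that is not a lower half has infinite [zg] and so imposes no constraint. *)
Lemma base_polytopeP x :
  base_polytope (zg R E) x <->
  sum_on x [set: I]%SET = 0 /\ forall A, lower_half E A -> sum_on x A <= 0.
Proof.
have sumT : sum_on x [set: I]%SET = \sum_i x i.
  by apply: eq_bigl => k; rewrite inE.
rewrite /base_polytope /= zg_setT sumT; split=> -[xT xA]; split.
- by case: xT.
- by move=> A lA; have := xA A; rewrite /zg lA lee_fin; apply; rewrite ltry.
- by rewrite xT.
- by move=> A; rewrite /zg; case: ifP => // /xA; rewrite lee_fin.
Qed.

Lemma cone_sub_base_polytope : Cone edge_dirs `<=` base_polytope (zg R E).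
Proof.
move=> _ [n [c [u [c0 Xu ->]]]]; apply/base_polytopeP.
have sumE A : sum_on (\sum_k c k *: u k) A = \sum_k c k * sum_on (u k) A.
  elim/big_ind2: _ => [|_ a _ b <- <-|k _]; last exact: sum_onZ.
    by rewrite /sum_on big1 // => k _; rewrite ffunE.
  exact: sum_onD.
split=> [|A /lower_halfP lA]; rewrite sumE.
  rewrite big1 // => k _; have [i [j [_ ->]]] := Xu k.
  by rewrite sum_on_dir !inE subrr mulr0.
(* A lower half containing the head [i] of an edge contains its tail [j], so each generator sums to
   0 or -1 over it. *)
apply: sumr_le0 => k _; apply: mulr_ge0_le0 => //.
have [i [j [Eji ->]]] := Xu k; rewrite sum_on_dir subr_le0 ler_nat.
by case: (boolP (i \in A)) => // /(lA _ _ Eji)->.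
Qed.

Lemma connect_cone i j :
  connect (edge E) j i -> Cone edge_dirs (basis_vec R i - basis_vec R j).
Proof.
move=> /connectP[p]; elim: p j => [j _ ->|k p IHp j /=].
  by rewrite subrr; exact: cone0.
move=> /andP[jk kp] iE.
rewrite -(subrKA (basis_vec R k)); apply: coneD; first exact: IHp kp iE.
by apply: cone_gen; exists k, j.
Qed.

(** * Tight lower halves and the inclusion of the polytope in the cone *)

Definition tight x A := lower_half E A && (sum_on x A == 0).

(** By modularity the sums over union and intersection add up to 0; both are nonpositive, so both
    vanish. *)
Lemma tightU x A B : base_polytope (zg R E) x ->
  tight x A -> tight x B -> tight x (A :|: B).
Proof.
move=> /base_polytopeP[_ xle] /andP[lA /eqP xA] /andP[lB /eqP xB].
have lU := lower_halfU lA lB; rewrite /tight lU eq_le xle //=.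
by have := sum_onUI x A B; have := xle _ (lower_halfI lA lB); lra.
Qed.

(** The last conclusion leaves slack in every lower half containing [j] but not [i], so that a
    positive amount can be moved. *)
Lemma exists_source x i : base_polytope (zg R E) x -> 0 < x i ->
  exists j, [/\ connect (edge E) j i, x j < 0 &
    forall A, tight x A -> j \in A -> i \in A].
Proof.
move=> Px xi; have /base_polytopeP[_ xle] := Px.
pose Q A := tight x A && (i \notin A).
have Q0 : Q finset.set0.
  rewrite /Q /tight /sum_on big_set0 eqxx inE !andbT.
  by apply/lower_halfP => u v _; rewrite inE.
have [U /maxsetP[/andP[tU iU] maxU] _] := maxset_exists Q0.
pose D := [set u | connect (edge E) u i]%SET.
have iD : i \in D :\: U by rewrite !inE connect0 iU.
have xD : sum_on x (D :\: U) <= 0.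
  have /andP[lU /eqP xU] := tU.
  have := xle _ (lower_halfU lU (lower_half_ancestors E i)).
  by rewrite {1}/sum_on (big_setID U) /= finset.setUK finset.setDUl finset.setDv finset.set0U
    -/(sum_on x U) -/(sum_on x (D :\: U)) xU add0r.
have [/existsP[j /andP[jD xj]]|noj] :=
    boolP [exists j, (j \in D :\: U) && (x j < 0)]; last first.
  suff : 0 < sum_on x (D :\: U) by rewrite ltNge xD.
  rewrite /sum_on (bigD1 i) //= ltr_wpDr // sumr_ge0 // => k /andP[kD _].
  by move: noj; rewrite negb_exists => /forallP/(_ k); rewrite kD -leNgt.
(* If a tight [A] contained [j] but not [i], then [U :|: A] would be tight and avoid [i], and
   maximality of [U] would put [j] in [U]. *)
move: jD; rewrite !inE => /andP[jU ji]; exists j; split=> // A tA jA.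
apply: contraNT jU => iA; rewrite -(maxU (U :|: A)) ?inE ?jA ?orbT //.
  by rewrite /Q tightU //= inE negb_or iU.
exact: finset.subsetUl.
Qed.

(* The number of steps in which mass can still be moved: each step makes a
   coordinate vanish or a lower half tight. *)
Definition defect x : nat :=
  #|[set k | x k != 0]%SET| +
  #|[set A | lower_half E A && (sum_on x A != 0)]%SET|.

Lemma defect_step x : base_polytope (zg R E) x -> x != 0 ->
  exists t i j, let y := x - t *: (basis_vec R i - basis_vec R j) in
  [/\ 0 <= t, connect (edge E) j i, base_polytope (zg R E) y &
      (defect y < defect x)%N].
Proof.
move=> Px x0; have /base_polytopeP[xT xle] := Px.
(* Otherwise all coordinates are nonpositive with sum 0, hence all vanish. *)
have [i xi] : exists i, 0 < x i.
  apply/existsP; apply: contraNT x0; rewrite negb_exists => /forallP xneg.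
  have x_le0 k : x k <= 0 by rewrite leNgt.
  apply/eqP/ffunP => k; rewrite ffunE; apply/eqP; rewrite eq_le x_le0 /=.
  move: xT; rewrite /sum_on (bigD1 k) ?inE //= => /eqP.
  rewrite addr_eq0 => /eqP ->; rewrite oppr_ge0.
  by apply: sumr_le0.
have [j [ji xj tj]] := exists_source Px xi.
have neij : i != j by apply: contraTneq xi => ->; rewrite -leNgt ltW.
have lji A : lower_half E A -> i \in A -> j \in A.
  by move=> lA; apply: lower_half_connect lA ji.
(* [None] stands for the bound imposed by the coordinates i and j. *)
pose cap (o : option {set I}) : R :=
  if o is Some A then - sum_on x A else Num.min (x i) (- x j).
(* A lower half containing [i] contains [j], so only those with [j] but not [i] change their sum: it
   grows by [t] and must stay nonpositive. *)
pose crossing (o : option {set I}) :=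
  if o is Some A then [&& lower_half E A, j \in A & i \notin A] else true.
have [o co ominle] :
    exists2 o, crossing o & forall o', crossing o' -> cap o <= cap o'.
  have crossN : crossing None by [].
  by case: (Order.TotalTheory.arg_minP cap crossN) => o co omin; exists o.
set t := cap o in ominle.
have t_le_xi : t <= x i.
  by have := ominle None isT; rewrite /= le_min => /andP[].
have t_le_xj : t <= - x j.
  by have := ominle None isT; rewrite /= le_min => /andP[].
(* By [tj] no crossing lower half is tight, so every bound is positive. *)
have t_gt0 : 0 < t.
  rewrite /t; case: (o) co => [A /and3P[lA jA iA]|_] /=.
    rewrite oppr_gt0 lt_neqAle xle // andbT.
    by apply: contraNneq iA => xA; apply: tj jA; rewrite /tight lA xA eqxx.
  by rewrite lt_min xi oppr_gt0.
exists t, i, j => y.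
have yE k : y k = x k - t * ((k == i)%:R - (k == j)%:R).
  by rewrite !ffunE.
have syE A : sum_on y A = sum_on x A - t * ((i \in A)%:R - (j \in A)%:R).
  by rewrite /y -scaleNr sum_onD sum_onZ sum_on_dir mulNr.
have sy_cross A : lower_half E A ->
    sum_on y A = sum_on x A + t * ((j \in A) && (i \notin A))%:R.
  move=> lA; rewrite syE; case: (boolP (i \in A)) => [/(lji _ lA)->|_] /=.
    by rewrite subrr mulr0 subr0 addr0.
  by rewrite andbT sub0r mulrN opprK.
split=> //; first exact: ltW.
  apply/base_polytopeP; split=> [|A lA].
    by rewrite syE !inE subrr mulr0 subr0.
  rewrite sy_cross //; have [cA|_] := boolP (_ && _); last first.
    by rewrite /= mulr0 addr0 xle.
  have : t <= cap (Some A) by apply: ominle; rewrite /= lA.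
  by rewrite /= mulr1; lra.
(* Only the coordinates [i] and [j] change, and both are nonzero in [x]. *)
have subN : [set k | y k != 0]%SET \subset [set k | x k != 0]%SET.
  apply/fintype.subsetP => k; rewrite !inE yE; apply: contraNneq => xk.
  have /negbTE -> : k != i by apply: contraTneq xi => <-; rewrite xk ltxx.
  have /negbTE -> : k != j by apply: contraTneq xj => <-; rewrite xk ltxx.
  by rewrite xk subrr mulr0 subr0.
have subL : [set A | lower_half E A && (sum_on y A != 0)]%SET \subset
            [set A | lower_half E A && (sum_on x A != 0)]%SET.
  apply/fintype.subsetP => A; rewrite !inE => /andP[lA].
  rewrite lA /=; apply: contraNneq => xA; rewrite sy_cross // xA.
  have [/andP[jA iA]|_] := boolP (_ && _); last by rewrite /= mulr0 addr0 eqxx.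
  by move: iA; rewrite (tj A) // /tight lA xA eqxx.
(* The bound attaining the minimum decides which count drops: for [Some A] the set [A] becomes
   tight, for [None] the coordinate [i] or [j] becomes 0. *)
rewrite /defect; case: o @t co ominle t_le_xi t_le_xj t_gt0 y yE syE sy_cross
  subN subL => [A|] t.
  move=> /and3P[lA jA iA] _ _ _ t_gt0 y yE syE sy_cross subN subL.
  rewrite -addnS leq_add ?subset_leq_card //; apply: proper_card.
  apply/properP; split=> //; exists A; rewrite !inE lA /=.
    by rewrite -oppr_eq0 gt_eqF.
  by rewrite sy_cross // jA iA mulr1 /t /= subrr eqxx.
move=> _ _ _ _ _ y yE _ _ subN subL.
rewrite -addSn leq_add ?subset_leq_card //; apply: proper_card.
apply/properP; split=> //.
have [xij|xji] := leP (x i) (- x j).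
  exists i; rewrite !inE; first by rewrite gt_eqF.
  rewrite yE eqxx (negbTE neij) subr0 mulr1.
  by rewrite /t /= min_l // subrr eqxx.
exists j; rewrite !inE; first by rewrite lt_eqF.
rewrite yE eqxx [j == i]eq_sym (negbTE neij) sub0r.
by rewrite /t /= min_r ?ltW // mulrN1 opprK subrr eqxx.
Qed.

Lemma base_polytope_sub_cone : base_polytope (zg R E) `<=` Cone edge_dirs.
Proof.
move=> x; have [n] := ubnP (defect x); elim: n x => // n IHn x dx Px.
have [->|x0] := eqVneq x 0; first exact: cone0.
have [t [i [j [t0 ji Py dy]]]] := defect_step Px x0.
rewrite -(subrK (t *: (basis_vec R i - basis_vec R j)) x).
apply: coneD; last exact: coneZ t0 (connect_cone ji).
by apply: IHn Py; apply: leq_trans dy _.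
Qed.

End BasePolytope.

Theorem theorem1p1 (R : realType) (I : finType) (E : {set I * I}) :
  base_polytope (zg R E) =
  Cone [set v : {ffun I -> R^o} | exists i j : I,
          (j, i) \in E /\ v = basis_vec R i - basis_vec R j].
Proof.
apply/seteqP; split; first exact: base_polytope_sub_cone.
exact: cone_sub_base_polytope.
Qed.
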